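(* The star of Cantor fans admits a transitive homeomorphism; that is, if $X$ is any star of Cantor fans, then there is a transitive homeomorphism $f:X\to X$.
   Context: A Cantor fan is any space homeomorphic to $\bigcup_{c\in C}S_c$, where $C\subseteq[0,1]$ is the standard middle-third Cantor set and $S_c$ is the straight line segment in the plane from $(0,0)$ to $(c,1)$; its top is the point corresponding to $(0,0)$. A star of Cantor fans is any space homeomorphic to $\bigcup_{n=1}^{\infty}F_n$, where $(F_n)$ is a sequence of subsets of the Euclidean plane such that: (1) each $F_n$ is homeomorphic to the Cantor fan; (2) $\operatorname{diam}(F_n)\le \frac{1}{2^n}$ for each positive integer $n$; (3) $(0,0)$ is the top of $F_n$ for each $n$; (4) $F_m\cap F_n=\{(0,0)\}$ for all positive integers $m\neq n$. (Any two stars of Cantor fans are homeomorphic.) A function $f:X\to X$ on a compact metric space is transitive if for all non-empty open sets $U,V\subseteq X$ there is a non-negative integer $n$ with $f^n(U)\cap V\neq\emptyset$. *)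

(* Defs.v *)
From HB Require Import structures.
From mathcomp Require Import all_boot all_order all_algebra.
From mathcomp Require Import all_classical all_reals all_analysis.
Set Implicit Arguments.
Unset Strict Implicit.
Unset Printing Implicit Defensive.
Import Order.TTheory GRing.Theory Num.Theory.
Import numFieldNormedType.Exports.

Local Open Scope classical_set_scope.
Local Open Scope ring_scope.

Definition homeomorphism (X Y : topologicalType) (f : X -> Y) : Prop :=
  continuous f /\
  exists g : Y -> X, [/\ cancel f g, cancel g f & continuous g].

Definition homeomorphic (X Y : topologicalType) : Prop :=
  exists f : X -> Y, homeomorphism f.

Definition topologically_transitive (X : topologicalType) (f : X -> X) : Prop :=
  forall U V : set X, open U -> open V -> U !=set0 -> V !=set0 ->
    exists n : nat, (iter n f @` U) `&` V !=set0.

(* The norm the library puts on the product R * R is the sup norm, so the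
   Euclidean distance is written out; the product topology is the Euclidean
   one. *)
Definition euclidean_dist (R : realType) (p q : R * R) : R :=
  Num.sqrt ((p.1 - q.1) ^+ 2 + (p.2 - q.2) ^+ 2).

(* Extended-real valued, so that an unbounded set has diameter +oo. *)
Definition euclidean_diam (R : realType) (A : set (R * R)) : \bar R :=
  ereal_sup [set (euclidean_dist z.1 z.2)%:E | z in A `*` A].

Fixpoint cantor_stage (R : realType) (n : nat) : set R :=
  if n is m.+1 then
    [set x / 3 | x in cantor_stage m] `|`
    [set (x + 2) / 3 | x in cantor_stage m]
  else `[0, 1].
Arguments cantor_stage R n : clear implicits.

Definition cantor_set (R : realType) : set R :=
  \bigcap_(n in [set: nat]) cantor_stage R n.
Arguments cantor_set R : clear implicits.

Definition plane_segment (R : realType) (a b : R * R) : set (R * R) :=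
  [set (1 - t) *: a + t *: b | t in `[0, 1]].

Definition cantor_fan (R : realType) : set (R * R) :=
  \bigcup_(c in cantor_set R) plane_segment (0, 0) (c, 1).
Arguments cantor_fan R : clear implicits.

Lemma cantor_fan00 (R : realType) : cantor_fan R (0, 0).
Proof.
exists 0.
  move=> n _; elim: n => [|n IHn] /=; first by rewrite in_itv /= lexx ler01.
  by left; exists 0 => //; rewrite mul0r.
exists 0; first by rewrite /= in_itv /= lexx ler01.
by rewrite subr0 scale1r scale0r addr0.
Qed.

(* A set coerces to its subtype [set_type], which carries the subspace
   topology. *)
Definition cantor_fan_apex (R : realType) : cantor_fan R :=
  SigSub (mem_set (cantor_fan00 R)).

Definition is_cantor_fan (R : realType) (Y : topologicalType) : Prop :=
  homeomorphic (cantor_fan R) Y.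

(* The apex is the only ramification point of the fan, so the top does not
   depend on the homeomorphism. *)
Definition is_cantor_fan_top (R : realType) (Y : topologicalType) (y : Y) :
    Prop :=
  exists h : cantor_fan R -> Y,
    homeomorphism h /\ h (cantor_fan_apex R) = y.

(* The sequence is indexed by the positive integers; F 0 is not used. *)
Definition star_sequence (R : realType) (F : nat -> set (R * R)) : Prop :=
  [/\ forall n, (0 < n)%N -> is_cantor_fan R (F n),
      forall n, (0 < n)%N -> (euclidean_diam (F n) <= (1 / 2 ^+ n)%:E)%E,
      forall n, (0 < n)%N ->
        exists2 y : F n, is_cantor_fan_top R y & set_val y = (0, 0)
    & forall m n, (0 < m)%N -> (0 < n)%N -> m <> n ->
        F m `&` F n = [set (0, 0)]].

Definition star_of_cantor_fans (R : realType) (X : topologicalType) : Prop :=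
  exists2 F : nat -> set (R * R), star_sequence F &
    homeomorphic (\bigcup_(n in [set n | (0 < n)%N]) F n) X.

(* Main.v *)
(* Let K be the Cantor space of bit sequences. Sending (0^n 1 y, t) to the point
   at height t on the leg y of the (n+1)-st fan, and (0, t) to the top, exhibits
   the star as the quotient of K x [0, 1] that collapses
   Z = {x = 0} u {t = 0}; continuity at x = 0 is the shrinking of the diameters.
   It therefore suffices to find a transitive homeomorphism of K x [0, 1] that
   preserves Z. View K as the two-sided full shift over a Cantor alphabet, with
   the zero sequence as a fixed point, and take the skew product
   (x, t) |-> (shift x, flow (g x) t), where flow is a one-parameter group of
   homeomorphisms of [0, 1] transitive on ]0, 1[, and g maps the letter of x at
   position 0 onto [-1, 1] by binary expansion. To go from one open box to
   another, keep the windows of the two boxes apart and fill the gap with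
   repetitions of one letter so that the total flow time is exactly the required
   one. *)

Require Import Defs.
From mathcomp Require Import all_boot all_order all_algebra.
From mathcomp Require Import all_classical all_reals all_analysis.
From mathcomp Require Import zify ring lra.

Set Implicit Arguments.
Unset Strict Implicit.
Unset Printing Implicit Defensive.
Import Order.TTheory GRing.Theory Num.Theory.
Import numFieldNormedType.Exports.

Local Open Scope classical_set_scope.
Local Open Scope ring_scope.

(** * Topology of the Cantor space of bit sequences *)

Lemma nbhs_cylinder (x : cantor_space) (n : nat) :
  nbhs x [set y : cantor_space | forall i, (i < n)%N -> y i = x i].
Proof.
elim: n => [|n IHn]; first exact: filterS filterT.
have xn : nbhs x [set y : cantor_space | y n = x n].
  exact: (@proj_continuous nat (fun=> bool) n x _ (discrete_set1 (x n))).
apply: filterS (filterI IHn xn) => y [yx ynx] i.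
by rewrite ltnS leq_eqVlt => /orP[/eqP ->|/yx].
Qed.

(** Otherwise each prefix of [x] extends to a point outside [A], and these points converge to [x]
    coordinatewise, hence in the product topology. *)
Lemma nbhs_cylinderP (x : cantor_space) (A : set cantor_space) :
  nbhs x A ->
  exists n, forall y : cantor_space, (forall i, (i < n)%N -> y i = x i) -> A y.
Proof.
move=> nA; apply: contrapT => /forallNP nE.
have {nE} /choice[g gP] : forall n, exists y : cantor_space,
    (forall i, (i < n)%N -> y i = x i) /\ ~ A y.
  move=> n; have /existsNP[y /not_implyP yP] := nE n; by exists y.
have gx : g @ \oo --> x.
  apply/cvg_sup => i U [V [[W] oW <-] Wxi WU]; apply: filterS WU _.
  exists i.+1 => // m /= im; rewrite /= (gP m).1//.
have [N _ /(_ N (leqnn N))] := gx _ nA.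
by move: (gP N).2.
Qed.

Lemma cantor_space_continuousP (T : topologicalType) (f : T -> cantor_space) :
  continuous f <-> forall i, continuous (fun t => f t i).
Proof.
split=> [cf i|cf].
  move=> t; apply: (@continuous_comp _ cantor_space bool f (fun x => x i)).
    exact: cf.
  exact: (@proj_continuous nat (fun=> bool) i (f t)).
move=> t; apply/cvg_sup => i U [V [[W] oW <-] Wfi WU].
apply: filterS WU _.
have Wt : nbhs (f t i) W by apply: open_nbhs_nbhs.
exact: (cf i t W Wt).
Qed.

Lemma cantor_space_reindex_continuous (s : nat -> nat) :
  continuous (fun x : cantor_space => x \o s : cantor_space).
Proof.
apply/cantor_space_continuousP => i.
exact: (@proj_continuous nat (fun=> bool) (s i)).
Qed.

(** * Digit expansions in a base [b] *)

Lemma exists_exp_half_lt (R : realType) (e : R) :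
  0 < e -> exists n, 2^-1 ^+ n < e.
Proof.
move=> e0; have half1 : `|2^-1 : R| < 1 by rewrite ger0_norm; lra.
have /cvgrPdist_lt/(_ e e0)[n _ /(_ n (leqnn n))] := cvg_expr half1.
by rewrite sub0r normrN => /(le_lt_trans (ler_norm _)) ?; exists n.
Qed.

(** Horner form of the partial sums of (b - 1) x_i / b^(i+1). Base 3 produces the points of the
    Cantor set, base 2 the binary expansions of numbers in [0, 1]. *)
Fixpoint truncated_expansion (R : realType) (b : R) (n : nat)
    (x : cantor_space) : R :=
  if n is m.+1 then
    ((b - 1) * (x 0)%:R + truncated_expansion b m (x \o S)) / b
  else 0.

Definition expansion (R : realType) (b : R) (x : cantor_space) : R :=
  limn (fun n => truncated_expansion b n x).

Section Expansion.
Context {R : realType} {b : R} (b2 : 2 <= b).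

Let b0 : 0 < b. Proof. exact: lt_le_trans b2. Qed.

Let b1 : 0 <= b - 1. Proof. by rewrite subr_ge0 (le_trans _ b2)// ler1n. Qed.

Lemma truncated_expansion_ge0 n x : 0 <= truncated_expansion b n x.
Proof.
elim: n x => //= n IHn x; rewrite divr_ge0 ?(ltW b0)// addr_ge0//.
by rewrite mulr_ge0// ler0n.
Qed.

Lemma truncated_expansion_le1 n x : truncated_expansion b n x <= 1.
Proof.
elim: n x => //= n IHn x; rewrite ler_pdivrMr// mul1r.
have := IHn (x \o S); case: (x 0); rewrite ?mulr1 ?mulr0; move: b2; lra.
Qed.

Lemma cvg_truncated_expansion x :
  (fun n => truncated_expansion b n x) @ \oo --> expansion b x.
Proof.
apply: nondecreasing_is_cvgn; last first.
  by exists 1 => _ [n _ <-]; exact: truncated_expansion_le1.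
apply/nondecreasing_seqP => n.
elim: n x => [|n IHn] x; first by rewrite truncated_expansion_ge0.
by rewrite /= ler_pM2r ?invr_gt0// lerD2l; exact: IHn.
Qed.

Lemma expansionE x :
  expansion b x = ((b - 1) * (x 0)%:R + expansion b (x \o S)) / b.
Proof.
move: (@cvg_truncated_expansion x); rewrite -(cvg_shiftS (fun n => _ n x)) => h.
apply: (@cvg_unique _ (@Rhausdorff R) _ _ _ _ h) => /=.
apply: cvgM; last exact: cvg_cst.
apply: cvgD; [exact: cvg_cst|exact: cvg_truncated_expansion].
Qed.

Lemma expansion_itv x : 0 <= expansion b x <= 1.
Proof.
apply/andP; split.
  apply: limr_ge; first by apply: cvgP; exact: cvg_truncated_expansion.
  by apply: nearW => n; exact: truncated_expansion_ge0.
apply: limr_le; first by apply: cvgP; exact: cvg_truncated_expansion.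
by apply: nearW => n; exact: truncated_expansion_le1.
Qed.

(** Each shared leading digit divides the distance by [b], hence at least halves it. *)
Lemma expansion_dist n x y : (forall i, (i < n)%N -> x i = y i) ->
  `|expansion b x - expansion b y| <= 2^-1 ^+ n.
Proof.
elim: n x y => [|n IHn] x y xy.
  rewrite expr0 ler_norml.
  have := expansion_itv x; have := expansion_itv y; lra.
rewrite (expansionE x) (expansionE y) (xy 0)//.
rewrite -mulrBl [X in X / b](_ : _ =
  expansion b (x \o S) - expansion b (y \o S)); last ring.
rewrite normrM normfV (gtr0_norm b0) exprS mulrC.
apply: ler_pM => //; first by rewrite invr_ge0 ltW.
  by rewrite lef_pV2 ?posrE//.
by apply: IHn => i ni; exact: xy.
Qed.

Lemma expansion_continuous : continuous (expansion b).
Proof.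
move=> x; apply/cvgrPdist_lt => e e0.
have [n ne] := exists_exp_half_lt e0.
apply: filterS (nbhs_cylinder x n) => y yx; apply: le_lt_trans ne.
by apply: expansion_dist => i /yx.
Qed.

(* The digit rule [d] need not be the greedy one: [A] only has to be invariant
   under the expanding map it induces. *)
Lemma expansion_surj (A : set R) (d : R -> bool) :
  A `<=` `[0, 1] -> (forall s, A s -> A (b * s - (b - 1) * (d s)%:R)) ->
  forall s, A s -> exists x, expansion b x = s.
Proof.
move=> A01 AA s As; pose T s := b * s - (b - 1) * (d s)%:R.
(* The digits are read along the orbit of [s] under the expanding map [T]; each step of [T] is
   undone by one contraction by 1 / b. *)
exists (fun n => d (iter n T s)).
suff dist n s' : A s' ->
    `|expansion b (fun n => d (iter n T s')) - s'| <= 2^-1 ^+ n.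
  apply/eqP; rewrite -subr_eq0 -normr_le0.
  apply: (@cvgr_to_ge _ \oo _ _ (fun n => (2^-1 : R) ^+ n)).
    by apply: cvg_expr; rewrite ger0_norm; lra.
  by apply: nearW => n; exact: dist.
elim: n s' => [|n IHn] s' As'.
  have /= := A01 _ As'; rewrite in_itv/= expr0 ler_norml.
  have := expansion_itv (fun n : nat => d (iter n T s')); lra.
have := IHn _ (AA _ As').
rewrite (expansionE (fun n => d (iter n T s'))) /=.
rewrite (_ : (fun n : nat => d (iter n T s')) \o _ =
  (fun n : nat => d (iter n T (T s')))); last first.
  by apply/funext => m /=; rewrite -iterSr.
rewrite -/(T s'); set z := expansion _ _ => zT.
rewrite [X in `|X|](_ : _ = b^-1 * (z - T s')); last first.
  by rewrite /T; field; rewrite gt_eqF.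
rewrite normrM normfV (gtr0_norm b0) exprS.
apply: ler_pM => //; first by rewrite invr_ge0 ltW.
by rewrite lef_pV2 ?posrE.
Qed.

End Expansion.

(** * Base 3 and the Cantor set; base 2 and the unit interval *)

Lemma cantor_set_expansion (R : realType) (x : cantor_space) :
  cantor_set R (expansion 3 x).
Proof.
move=> n _; elim: n x => [|n IHn] x.
  by rewrite /= in_itv/=; apply: expansion_itv; lra.
rewrite expansionE; last by lra.
case: (x 0); [right|left]; (exists (expansion 3 (x \o S)); first exact: IHn).
  by rewrite mulr1 addrC; congr (_ / _); congr (_ + _); lra.
by rewrite mulr0 add0r.
Qed.

(** A leading bit 0 gives a value at most 1/3 and a leading bit 1 a value at least 2/3, so the value
    determines the first bit and then the value of the rest. *)
Lemma cantor_expansion_inj (R : realType) : injective (@expansion R 3).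
Proof.
have b2 : (2 : R) <= 3 by lra.
have head (x y : cantor_space) : expansion 3 x = expansion 3 y :> R ->
    x 0 = y 0 /\ expansion 3 (x \o S) = expansion 3 (y \o S) :> R.
  rewrite (expansionE b2 x) (expansionE b2 y).
  have := expansion_itv b2 (x \o S); have := expansion_itv b2 (y \o S).
  case: (x 0) (y 0) => -[]; rewrite ?(mulr0, mulr1) => ? ? ?; split=> //; lra.
move=> x y xy; apply/funext => n; elim: n x y xy => [|n IHn] x y /head[//].
by move=> _ /IHn.
Qed.

(** At each stage the point comes from the left or the right third, a choice that could depend on
    the stage. The side of 1/2 on which [c] lies settles it uniformly, since the other preimage
    falls outside [0, 1]. *)
Lemma cantor_set_third (R : realType) (c : R) : cantor_set R c ->
  exists d : bool, cantor_set R (3 * c - (3 - 1) * d%:R).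
Proof.
move=> Cc; have stageP n : cantor_stage R n.+1 c ->
    cantor_stage R n (3 * c) \/ cantor_stage R n (3 * c - 2).
  by move=> [[z ? <-]|[z ? <-]]; [left|right];
    rewrite mulrCA divff ?mulr1 ?addrK.
have stage01 n : cantor_stage R n `<=` `[0, 1].
  elim: n => // n IHn y [[z /IHn] /=|[z /IHn]/=]; rewrite !in_itv/= => ? <-; lra.
have [c12|c12] := leP c (1 / 2).
  exists false => n _; rewrite mulr0 subr0.
  by have [//|/stage01] := stageP n (Cc n.+1 I); rewrite /= in_itv/=; lra.
exists true => n _; rewrite mulr1 (_ : 3 * c - _ = 3 * c - 2); last by lra.
by have [/stage01|//] := stageP n (Cc n.+1 I); rewrite /= in_itv/=; lra.
Qed.

Lemma cantor_expansion_surj (R : realType) (c : R) : cantor_set R c ->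
  exists x, expansion 3 x = c.
Proof.
have /choice[d dP] (z : R) : exists d : bool, cantor_set R z ->
    cantor_set R (3 * z - (3 - 1) * d%:R).
  have [/cantor_set_third[d]|nCz] := pselect (cantor_set R z).
    by exists d.
  (* Arbitrary digit off the Cantor set. *)
  by exists true => /nCz.
apply: (expansion_surj _ _ dP); first lra.
by move=> z /(_ 0%N I).
Qed.

Lemma binary_expansion_surj (R : realType) (s : R) : 0 <= s <= 1 ->
  exists x, expansion 2 x = s.
Proof.
move=> s01; apply: (@expansion_surj _ _ _ `[0, 1]%classic
  (fun z => 1 / 2 <= z)) => //.
move=> z /=; rewrite !in_itv/=.
by case: (leP (1 / 2) z); rewrite ?(mulr1, mulr0); lra.
Qed.

(** * The two ingredients of the skew product: flow and shift *)

Lemma bijective_nat_int_nat : exists e : nat -> int * nat, bijective e.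
Proof.
suff /card_set_bijP[r] : ([set: int * nat] #= [set: nat])%card.
  by rewrite setTT_bijective => -[e eK rK]; exists e; exists r.
apply: eq_card_nat; first exact: countableP.
move=> /(finite_image snd); rewrite [X in finite_set X](_ : _ = setT).
  exact: infinite_nat.
by rewrite -subTset => n _; exists (0, n).
Qed.

(* Conjugate to translation by [v] on the line through the logistic
   coordinate [ln (t / (1 - t))]. *)
Definition flow (R : realType) (v t : R) : R := t / (t + (1 - t) * expR (- v)).

Section Flow.
Context {R : realType}.
Implicit Types v w t : R.

Lemma flow_denominator_gt0 v t : 0 <= t <= 1 ->
  0 < t + (1 - t) * expR (- v).
Proof.
move=> /andP[t0 t1]; have := expR_gt0 (- v); move: t1.
rewrite le_eqVlt => /predU1P[->|t1] e0; first by rewrite subrr mul0r addr0.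
by rewrite ltr_wpDl// mulr_gt0// subr_gt0.
Qed.

Lemma flow_itv v t : 0 <= t <= 1 -> 0 <= flow v t <= 1.
Proof.
move=> t01; have d0 := flow_denominator_gt0 v t01; have [t0 t1] := andP t01.
rewrite /flow divr_ge0 ?(ltW d0)//= ler_pdivrMr// mul1r lerDl.
by rewrite mulr_ge0 ?expR_ge0// subr_ge0.
Qed.

Lemma flow0 t : flow 0 t = t.
Proof. by rewrite /flow oppr0 expR0 mulr1 subrKC divr1. Qed.

(** Together with [flow0], this inverts the fibre maps and turns iterates of the skew product into
    sums of flow times. *)
Lemma flow_comp v w t : 0 <= t <= 1 -> flow v (flow w t) = flow (v + w) t.
Proof.
move=> t01; have d0 := flow_denominator_gt0 w t01.
have dvw := flow_denominator_gt0 (v + w) t01.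
have := flow_denominator_gt0 v (flow_itv w t01).
move: dvw; rewrite /flow opprD expRD; set p := expR (- v); set q := expR (- w).
move=> dvw dv; field; rewrite !gt_eqF//=.
Qed.

Lemma flow_transitive t r : 0 < t < 1 -> 0 < r < 1 -> exists v, flow v t = r.
Proof.
move=> /andP[t0 t1] /andP[r0 r1].
(* The difference of the logistic coordinates of [r] and [t]. *)
exists (- ln (t * (1 - r) / (r * (1 - t)))).
have p0 : 0 < t * (1 - r) / (r * (1 - t)).
  by rewrite divr_gt0// mulr_gt0// subr_gt0.
rewrite /flow opprK lnK ?posrE//; field.
by rewrite -mulrDr subrKC mulr1 !gt_eqF// subr_gt0.
Qed.

Lemma flow_continuous (T : topologicalType) (v t : T -> R) :
  continuous v -> continuous t -> (forall x, 0 <= t x <= 1) ->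
  continuous (fun x => flow (v x) (t x)).
Proof.
move=> cv ct t01 x; apply: cvgM; first exact: ct.
apply: cvgV; first by rewrite gt_eqF// flow_denominator_gt0.
apply: cvgD; first exact: ct.
apply: cvgM; first by apply: cvgB; [exact: cvg_cst|exact: ct].
apply: continuous_cvg; first exact: continuous_expR.
by apply: cvgN; exact: cv.
Qed.

End Flow.
(* Indexing the bits by [int * nat] turns [cantor_space] into the full shift
   over the Cantor alphabet; [g] reads the letter at position 0, so the letters
   between two prescribed windows can be chosen to give the sum any value. *)
Lemma cantor_shift_cocycle (R : realType) :
  exists (s s' : cantor_space -> cantor_space) (g : cantor_space -> R),
    [/\ continuous s, continuous s', cancel s s', cancel s' s & continuous g] /\
    s (fun=> false) = (fun=> false) /\
    forall (x y : cantor_space) (N : nat) (v : R), exists (n : nat) z,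
      [/\ forall i, (i < N)%N -> z i = x i,
          forall i, (i < N)%N -> iter n s z i = y i &
          \sum_(0 <= i < n) g (iter i s z) = v].
Proof.
have [e [r eK rK]] := bijective_nat_int_nat.
(* [tr c] moves a bit index by [c] letters; below, [row x c] is the letter of [x] at position
   [c]. *)
pose tr (c : int) (i : nat) := r ((e i).1 + c, (e i).2).
pose s (x : cantor_space) : cantor_space := x \o tr 1.
pose letter (w : cantor_space) : R := 2 * expansion 2 w - 1.
pose row (x : cantor_space) (c : int) : cantor_space := fun j => x (r (c, j)).
have sE n x i : iter n s x i = x (tr n%:Z i).
  elim: n x i => [|n IHn] x i; first by rewrite /tr addr0 -surjective_pairing eK.
  by rewrite iterSr IHn /s /tr /= rK /=; congr (x (r (_, _))); lia.
have rowE n x : row (iter n s x) 0 = row x n%:Z.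
  by apply/funext => j; rewrite /row sE /tr rK add0r.
have letter_surj u : -1 <= u <= 1 -> exists a, letter a = u.
  move=> u1; have [|a aE] := @binary_expansion_surj R ((u + 1) / 2); first lra.
  by exists a; rewrite /letter aE; field.
exists s, (fun x => x \o tr (-1)), (fun x => letter (row x 0)); split; split.
- exact: cantor_space_reindex_continuous.
- exact: cantor_space_reindex_continuous.
- move=> x; apply/funext => i; rewrite /s /tr /= rK /= subrK.
  by rewrite -surjective_pairing eK.
- move=> x; apply/funext => i; rewrite /s /tr /= rK /= addrK.
  by rewrite -surjective_pairing eK.
- move=> x; apply: cvgB; last exact: cvg_cst.
  apply: cvgM; first exact: cvg_cst.
  apply: (continuous_comp (g := expansion 2)).
    exact: (@cantor_space_reindex_continuous (fun j => r (0, j))).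
  by apply: expansion_continuous.
- by [].
(* The first [N] bits all belong to letters at positions strictly between -M and M. *)
move=> x y N v; pose M := (\max_(i < N) `|(e i).1|%N).+1.
have NM i : (i < N)%N -> (`|(e i).1| < M)%N.
  by move=> iN; rewrite ltnS; exact: (leq_bigmax (Ordinal iN)).
pose A := \sum_(0 <= i < M) letter (row x i%:Z).
pose B := \sum_(0 <= i < M) letter (row y (i%:Z - M%:Z)).
(* The remaining time [v - A - B] is shared equally by [m] letters, whose common value must lie in
   [-1, 1]; the successor also keeps [m] positive. *)
have [m m0 mAB] : exists2 m : nat, (0 < m)%N & `|v - A - B| <= m%:R.
  exists (Num.truncn `|v - A - B|).+1 => //.
  exact/ltW/truncnS_gt.
have mR0 : (0 : R) < m%:R by rewrite ltr0n.
have [a aE] : exists a, letter a = (v - A - B) / m%:R.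
  apply: letter_surj; rewrite -ler_norml normrM normfV (gtr0_norm mR0).
  by rewrite ler_pdivrMr// mul1r.
pose n := (M + m + M)%N.
(* Letters of [x] before [M], then [m] copies of [a], then [y] delayed by [n]. Positions M + m to n
   - 1 thus carry the letters of [y] at -M to -1, which contribute [B]. *)
pose z : cantor_space := fun i =>
  if (e i).1 < M%:Z then x i
  else if (e i).1 < (M + m)%:Z then a (e i).2
  else y (tr (- n%:Z) i).
exists n, z; split.
- by move=> i /NM iM; rewrite /z ifT//; lia.
- move=> i /NM iM; rewrite sE /z {1 2}/tr rK /= ifF; last by lia.
  rewrite ifF; last by lia.
  by rewrite /tr rK /= addrK -surjective_pairing eK.
under eq_bigr do rewrite rowE.
rewrite (@big_cat_nat _ _ _ (M + m))//=; last by rewrite /n leq_addr.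
rewrite (@big_cat_nat _ _ _ M)//=; last by rewrite leq_addr.
have -> : \sum_(0 <= i < M) letter (row z i) = A.
  apply: eq_big_nat => i iM; congr letter; apply/funext => j.
  by rewrite /row /z rK /= ifT//; lia.
have -> : \sum_(M <= i < M + m) letter (row z i) = v - A - B.
  rewrite (@eq_big_nat _ _ _ _ _ _ (fun=> letter a)).
    by rewrite sumr_const_nat addKn aE -[LHS]mulr_natr mulfVK// gt_eqF.
  move=> i iM; congr letter; apply/funext => j.
  rewrite /row /z rK /= ifF; last by lia.
  by rewrite ifT//; lia.
have -> : \sum_(M + m <= i < n) letter (row z i) = B.
  rewrite -{1}[(M + m)%N]add0n big_addn /n addKn.
  apply: eq_big_nat => i iM; congr letter; apply/funext => j.
  rewrite /row /z rK /= ifF; last by lia.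
  rewrite ifF; last by lia.
  by rewrite /tr rK /=; congr (y (r (_, _))); rewrite /n; lia.
by ring.
Qed.

(** * Passing the skew product to the quotient *)

Lemma pair_continuous (S T U : topologicalType) (f : S -> T) (g : S -> U) :
  continuous f -> continuous g -> continuous (fun x => (f x, g x)).
Proof. by move=> cf cg x; exact: (cvg_pair (cf x) (cg x)). Qed.

(** From a compact set to a Hausdorff space, [q] sends closed subsets of [D] to closed sets. The
    preimage of a closed set under the induced map is such an image. *)
Lemma descend_continuous (Q X : topologicalType) (D : set Q) (q : Q -> X)
    (H : Q -> Q) :
  hausdorff_space X -> compact D -> continuous q -> continuous H ->
  (forall x, exists2 a, D a & q a = x) ->
  (forall a b, D a -> D b -> q a = q b -> q (H a) = q (H b)) ->
  exists2 f : X -> X, continuous f & forall a, D a -> f (q a) = q (H a).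
Proof.
move=> hX cD cq cH sq qH.
have /choice[r rP] : forall x, exists a, D a /\ q a = x.
  by move=> x; have [a] := sq x; exists a.
have fq a : D a -> q (H (r (q a))) = q (H a).
  by move=> Da; have [? ?] := rP (q a); exact: qH.
exists (q \o H \o r) => //; apply/continuous_closedP => A cA.
suff -> : (q \o H \o r) @^-1` A = q @` (D `&` (q \o H) @^-1` A).
  apply: compact_closed => //; apply: continuous_compact.
    exact: continuous_subspaceT.
  apply: compact_closedI => //; have /continuous_closedP : continuous (q \o H).
    by move=> a; apply: continuous_comp; [exact: cH|exact: cq].
  exact.
apply/seteqP; split => [x Ax|_ [a [Da Aa] <-]].
  by exists (r x); [split; [exact: (rP x).1|]|exact: (rP x).2].
by rewrite /= fq.
Qed.

Definition clamp (R : realType) (t : R) : R := Num.max 0 (Num.min 1 t).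

Lemma clamp_itv (R : realType) (t : R) : 0 <= clamp t <= 1.
Proof. by rewrite /clamp le_max lexx ge_max ler01 ge_min lexx. Qed.

Lemma clamp_id (R : realType) (t : R) : 0 <= t <= 1 -> clamp t = t.
Proof. by move=> /andP[t0 t1]; rewrite /clamp (min_idPr t1) (max_idPr t0). Qed.

Lemma clamp_continuous (R : realType) : continuous (@clamp R).
Proof.
move=> t; apply: (@continuous_max R R (cst 0) (fun t => Num.min 1 t)).
  exact: cvg_cst.
by apply: (@continuous_min R R (cst 1) id); [exact: cvg_cst|exact: cvg_id].
Qed.

(** A small move towards the middle leaves the endpoints, which the flow fixes and where it cannot
    be transitive. *)
Lemma nbhs_open_unit_interval (R : realType) (t : R) (A : set R) :
  0 <= t <= 1 -> nbhs t A -> exists2 r, 0 < r < 1 & A r.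
Proof.
move=> t01 /nbhs_ballP[d /= d0 tA].
pose e := Num.min d 1.
have e0 : 0 < e by rewrite lt_min d0 ltr01.
have ed : e <= d by rewrite ge_min lexx.
have e1 : e <= 1 by rewrite ge_min lexx orbT.
have [t1|t1] := leP t (1 / 2).
  exists (t + e / 4); first lra.
  by apply: tA; rewrite /ball /= opprD addNKr normrN gtr0_norm; lra.
exists (t - e / 4); first lra.
by apply: tA; rewrite /ball /= opprB addrC subrK gtr0_norm; lra.
Qed.

Lemma transitive_homeomorphism_of_quotient (R : realType) (X : topologicalType)
    (q : cantor_space * R -> X) :
  hausdorff_space X -> continuous q ->
  (forall x, exists k t, 0 <= t <= 1 /\ q (k, t) = x) ->
  (forall k l t u, 0 <= t <= 1 -> 0 <= u <= 1 ->
    q (k, t) = q (l, u) <->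
    (k, t) = (l, u) \/
    ((k = (fun=> false) \/ t = 0) /\ (l = (fun=> false) \/ u = 0))) ->
  exists f : X -> X, homeomorphism f /\ topologically_transitive f.
Proof.
move=> hX cq sq qP; pose D : set (cantor_space * R) := setT `*` `[0, 1].
have DE k t : D (k, t) <-> 0 <= t <= 1.
  by rewrite /D /= in_itv/=; split=> [[]|].
have cD : compact D.
  by apply: compact_setX; [exact: cantor_space_compact|exact: segment_compact].
have surj x : exists2 a, D a & q a = x.
  by have [k [t [t01 <-]]] := sq x; exists (k, t) => //; exact/DE.
have [s [s' [g [[cs cs' sK s'K cg] [s0 sg]]]]] := cantor_shift_cocycle R.
have s'0 : s' (fun=> false) = (fun=> false) by rewrite -{1}s0 sK.
pose H (h : cantor_space -> cantor_space) (v : cantor_space -> R)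
  (a : cantor_space * R) := (h a.1, flow (v a.1) (clamp a.2)).
have cH h v : continuous h -> continuous v -> continuous (H h v).
  move=> ch cv; apply: pair_continuous.
    by move=> a; apply: continuous_comp; [exact: cvg_fst|exact: ch].
  apply: (@flow_continuous R _ (v \o fst) (@clamp R \o snd)).
  - by move=> b; apply: continuous_comp; [exact: cvg_fst|exact: cv].
  - by move=> b; apply: continuous_comp; [exact: cvg_snd|exact: clamp_continuous].
  - by move=> b; exact: clamp_itv.
have HE h v k t : 0 <= t <= 1 -> H h v (k, t) = (h k, flow (v k) t).
  by move=> t01; rewrite /H /= clamp_id.
have HD h v a : D a -> D (H h v a).
  by move=> _; apply/DE; exact/flow_itv/clamp_itv.
have qH h v : h (fun=> false) = (fun=> false) ->
    forall a b, D a -> D b -> q a = q b -> q (H h v a) = q (H h v b).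
  have Z w t : 0 <= t <= 1 -> t = 0 -> flow w t = 0 :> R.
    by move=> _ ->; rewrite /flow mul0r.
  move=> h0 [k t] [l u] /DE t01 /DE u01; rewrite !HE//.
  move=> /(qP _ _ _ _ t01 u01)[[-> ->]//|[kt lu]].
  apply/qP; [exact: flow_itv|exact: flow_itv|right; split].
    by case: kt => [->|/Z ->]; [left|right|].
  by case: lu => [->|/Z ->]; [left|right|].
have [f cf fq] := descend_continuous hX cD cq (cH s g cs cg) surj (qH _ _ s0).
(* Inverting the skew product undoes the flow time read at the preimage [s' k]. *)
pose g' k := - g (s' k).
have cg' : continuous g'.
  by move=> k; apply: cvgN; apply: continuous_comp; [exact: cs'|exact: cg].
have [f' cf' f'q] :=
  descend_continuous hX cD cq (cH s' g' cs' cg') surj (qH _ _ s'0).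
exists f; split; first split=> //.
  exists f'; split=> // x; have [[k t] Da <-] := surj x.
    rewrite fq// f'q; last exact: HD.
    move/DE: Da => t01. rewrite (HE s g)// HE ?flow_itv//.
    by rewrite flow_comp// /g' sK addNr flow0.
  rewrite f'q// fq; last exact: HD.
  move/DE: Da => t01; rewrite (HE s' g')// HE ?flow_itv//.
  by rewrite flow_comp// /g' s'K subrr flow0.
have iterf n k t : 0 <= t <= 1 -> iter n f (q (k, t)) =
    q (iter n s k, flow (\sum_(0 <= i < n) g (iter i s k)) t).
  move=> t01; elim: n => [|n IHn]; first by rewrite big_nil flow0.
  rewrite iterS IHn fq; last exact/DE/flow_itv.
  by rewrite HE ?flow_itv// flow_comp// big_nat_recr//= addrC.
have openP U : open U -> U !=set0 -> exists k t N, 0 < t < 1 /\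
    forall l, (forall i, (i < N)%N -> l i = k i) -> U (q (l, t)).
  move=> oU [x Ux]; have [k [t [t01 qx]]] := sq x.
  have : nbhs (k, t) (q @^-1` U).
    by apply: cq; rewrite qx; exact: open_nbhs_nbhs.
  move=> [[A B] [/= /nbhs_cylinderP[N NA] tB]] AB.
  have [r r01 Br] := nbhs_open_unit_interval t01 tB.
  by exists k, r, N; split=> // l lk; apply: (AB (l, r)); split=> //=; exact: NA.
move=> U V oU oV /(openP _ oU)[x [t [N [t01 NU]]]].
move=> /(openP _ oV)[y [r [M [r01 MV]]]].
have [v vE] := flow_transitive t01 r01.
(* One window length serves both cylinders: [(z, t)] lies over [U], and after [n] steps its height
   is exactly [r] and its sequence lies in the cylinder for [V]. *)
have [n [z [zx zy zv]]] := sg x y (maxn N M) v.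
exists n, (q (iter n s z, r)); split; last first.
  by apply: MV => i iM; apply: zy; rewrite leq_max iM orbT.
exists (q (z, t)).
  by apply: NU => i iN; apply: zx; rewrite leq_max iN.
by rewrite iterf ?zv ?vE//; case/andP: t01 => /ltW -> /ltW ->.
Qed.

(** * Parametrization of the fan and of the star *)

Lemma hausdorff_injective (X Y : topologicalType) (f : X -> Y) :
  hausdorff_space Y -> continuous f -> injective f -> hausdorff_space X.
Proof.
move=> hY cf injf p q pq; apply/injf/hY => A B fA fB.
by have [z [Az Bz]] := pq _ _ (cf _ _ fA) (cf _ _ fB); exists (f z).
Qed.

Lemma plane_hausdorff (R : realType) : hausdorff_space (R * R)%type.
Proof. exact: norm_hausdorff. Qed.

Lemma set_val_continuous (T : topologicalType) (A : set T) :
  continuous (set_val : A -> T).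
Proof. exact: initial_continuous. Qed.

Lemma set_val_inj (T : Type) (A : set T) : injective (set_val : A -> T).
Proof. exact: val_inj. Qed.

Lemma plane_segment0E (R : realType) (c t : R) :
  (1 - t) *: ((0, 0) : R * R) + t *: (c, 1) = (t * c, t).
Proof.
by rewrite [LHS]surjective_pairing /= !scaler0 !add0r [t%:A]mulr1.
Qed.

(** The point (t c, t), with [c] the base 3 expansion of [k], shows [t] as its second coordinate;
    when t is nonzero, division recovers [c] and hence [k]. *)
Lemma cantor_fan_parametrization (R : realType) :
  exists p : cantor_space * R -> cantor_fan R,
    [/\ continuous p,
        forall y, exists k t, 0 <= t <= 1 /\ p (k, t) = y,
        forall k, p (k, 0) = cantor_fan_apex R &
        forall k l t u, 0 <= t <= 1 -> 0 <= u <= 1 ->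
          p (k, t) = p (l, u) -> (k, t) = (l, u) \/ (t = 0 /\ u = 0)].
Proof.
pose raw (a : cantor_space * R) : R * R :=
  (clamp a.2 * expansion 3 a.1, clamp a.2).
have raw_fan a : cantor_fan R (raw a).
  exists (expansion 3 a.1); first exact: cantor_set_expansion.
  exists (clamp a.2); first by rewrite /= in_itv/=; exact: clamp_itv.
  exact: plane_segment0E.
pose p a : cantor_fan R := SigSub (mem_set (raw_fan a)).
have clamp0 : clamp 0 = 0 :> R by rewrite clamp_id// lexx ler01.
exists p; split.
- have cr : continuous (set_val \o p).
    have cc : continuous (fun a : cantor_space * R => clamp a.2).
      move=> a; apply: continuous_comp; first exact: cvg_snd.
      exact: clamp_continuous.
    apply: pair_continuous => // a; apply: cvgM; first exact: cc.
    apply: continuous_comp; first exact: cvg_fst.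
    by apply: expansion_continuous; lra.
  exact: continuous_comp_initial cr.
- move=> [y yfan]; have [c Cc [t]] := set_mem yfan.
  rewrite /= in_itv/= plane_segment0E => t01 yE.
  have [k kc] := cantor_expansion_surj Cc.
  exists k, t; split=> //; apply: val_inj => /=.
  by rewrite /raw /= clamp_id// kc.
- by move=> k; apply: val_inj; rewrite /= /raw /= clamp0 mul0r.
- move=> k l t u t01 u01 /(congr1 val) /=; rewrite /raw /= !clamp_id// => -[+ tu].
  rewrite -{}tu in u01 *; have [->|t0] := eqVneq t 0; first by right.
  by move=> /(mulfI t0)/cantor_expansion_inj ->; left.
Qed.

Lemma cantor_space_lead (k : cantor_space) : k = (fun=> false) \/
  exists n, (forall i, (i < n)%N -> k i = false) /\ k n.
Proof.
have [kn|nk] := pselect (exists n, k n).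
  right; case: (ex_minnP kn) => n kn' nmin; exists n; split=> // i iln.
  by apply/negbTE/negP => /nmin; rewrite leqNgt iln.
by left; apply/funext => n; apply/negbTE/negP => knn; apply: nk; exists n.
Qed.

(** Lets the Euclidean diameter bounds control the sup norm, in which continuity is checked. *)
Lemma ler_norm_euclidean (R : realType) (z : R * R) :
  `|z| <= euclidean_dist z (0, 0).
Proof.
rewrite prod_normE /euclidean_dist !subr0 ge_max -!sqrtr_sqr.
by rewrite !ler_sqrt ?addr_ge0 ?sqr_ge0// lerDl lerDr !sqr_ge0.
Qed.

Lemma ler_norm_diam (R : realType) (A : set (R * R)) (z : R * R) :
  A (0, 0) -> A z -> ((`|z|)%:E <= euclidean_diam A)%E.
Proof.
move=> A0 Az; apply: (@le_trans _ _ (euclidean_dist z (0, 0))%:E).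
  by rewrite lee_fin ler_norm_euclidean.
by apply: ereal_sup_ubound; exists (z, (0, 0)).
Qed.

Lemma star_parametrization (R : realType) (F : nat -> set (R * R)) :
  star_sequence F ->
  exists G : cantor_space * R -> R * R,
    [/\ continuous G,
        forall a, (\bigcup_(n in [set n | (0 < n)%N]) F n) (G a),
        forall y, (\bigcup_(n in [set n | (0 < n)%N]) F n) y ->
          exists k t, 0 <= t <= 1 /\ G (k, t) = y &
        forall k l t u, 0 <= t <= 1 -> 0 <= u <= 1 ->
          G (k, t) = G (l, u) <->
          (k, t) = (l, u) \/
          ((k = (fun=> false) \/ t = 0) /\ (l = (fun=> false) \/ u = 0))].
Proof.
move=> [_ diamF topF disjF].
have [p [cp sp p0 injp]] := cantor_fan_parametrization R.
have topH n : exists h : cantor_fan R -> F n.+1,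
    homeomorphism h /\ set_val (h (cantor_fan_apex R)) = (0, 0).
  by have [//|y [h [hh <-]] y0] := topF n.+1; exists h.
pose h n := projT1 (cid (topH n)).
have ch n : continuous (h n) by have [[]] := projT2 (cid (topH n)).
have hinj n : injective (h n).
  have [[_ [h' [hK _ _]]] _] := projT2 (cid (topH n)).
  exact: can_inj hK.
have hsurj n y : exists x, h n x = y.
  have [[_ [h' [_ h'K _]]] _] := projT2 (cid (topH n)).
  by exists (h' y); exact: h'K.
have h0 n : set_val (h n (cantor_fan_apex R)) = (0, 0).
  by have [] := projT2 (cid (topH n)).
have hF n x : F n.+1 (set_val (h n x)) by exact: set_valP.
have F0 n : F n.+1 (0, 0) by rewrite -(h0 n).
(* Removes the prefix 0^n 1; the remaining bits name a leg of the fan [F n.+1]. *)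
pose tail n (k : cantor_space) : cantor_space := k \o addn n.+1.
pose leaf n (a : cantor_space * R) : R * R :=
  set_val (h n (p (tail n a.1, a.2))).
have cleaf n : continuous (leaf n).
  have ctail : continuous (fun a : cantor_space * R => (tail n a.1, a.2)).
    apply: pair_continuous; last by move=> a; exact: cvg_snd.
    move=> a; apply: continuous_comp; first exact: cvg_fst.
    exact: cantor_space_reindex_continuous.
  move=> a; apply: (@continuous_comp _ _ _ (h n \o p \o _) set_val).
    apply: (@continuous_comp _ _ _ (fun a => (tail n a.1, a.2)) (h n \o p)).
      exact: ctail.
    by apply: continuous_comp; [exact: cp|exact: ch].
  exact: set_val_continuous.
have leaf0 n k : leaf n (k, 0) = (0, 0) by rewrite /leaf p0 h0.
have leaf_eq0 n k t : 0 <= t <= 1 -> leaf n (k, t) = (0, 0) -> t = 0.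
  move=> t01; rewrite -(leaf0 n k) => /set_val_inj/hinj.
  by move=> /injp[//|//|[]//|[]//]; rewrite lexx ler01.
pose G (a : cantor_space * R) : R * R :=
  if pselect (exists n, a.1 n) is left P then leaf (ex_minn P) a else (0, 0).
have G0 t : G (fun=> false, t) = (0, 0).
  by rewrite /G; case: pselect => // -[].
have Glead n k t : (forall i, (i < n)%N -> k i = false) -> k n ->
    G (k, t) = leaf n (k, t).
  move=> kn0 kn; rewrite /G; case: pselect => [P|[]]; last by exists n.
  case: ex_minnP => m /= km mmin; congr (leaf _ _); apply/eqP.
  rewrite eqn_leq mmin//= leqNgt; apply/negP => mn.
  by move: km; rewrite kn0.
have GZ k t : k = (fun=> false) \/ t = 0 -> G (k, t) = (0, 0).
  move=> [->//|->]; have [->//|[n [kn0 kn]]] := cantor_space_lead k.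
  by rewrite (Glead n).
have G_eq0 k t : 0 <= t <= 1 -> G (k, t) = (0, 0) -> k = (fun=> false) \/ t = 0.
  move=> t01; have [->|[n [kn0 kn]]] := cantor_space_lead k; first by left.
  by rewrite (Glead n)// => /leaf_eq0 ->//; right.
exists G; split.
- move=> [k t]; have [->|[n [kn0 kn]]] := cantor_space_lead k; last first.
    (* A cylinder of [n.+1] bits fixes the position of the first true bit, so [G] stays in one fan
       there. *)
    have near_leaf : \forall a \near (k, t), leaf n a = G a.
      exists ([set l : cantor_space | forall i, (i < n.+1)%N -> l i = k i], setT).
        by split; [exact: nbhs_cylinder|exact: filterT].
      move=> [l u] [/= lk _]; rewrite (Glead n)// ?lk//.
      by move=> i iln; rewrite lk ?kn0// ltnW.
    rewrite /continuous_at (Glead n)//.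
    by apply: cvg_trans (cleaf n (k, t)); exact: near_eq_cvg.
  rewrite /continuous_at G0; apply/cvgrPdist_lt => e e0.
  have [N Ne] := exists_exp_half_lt e0.
  exists ([set l : cantor_space | forall i, (i < N)%N -> l i = false], setT).
    by split; [exact: nbhs_cylinder|exact: filterT].
  move=> [l u] [/= lN _]; rewrite distrC subr0; apply: le_lt_trans Ne.
  have [->|[n [ln0 ln]]] := cantor_space_lead l.
    by rewrite G0 normr0 exprn_ge0// invr_ge0.
  (* The point then lies in [F n.+1], which contains the origin and has diameter at most 2^-(n+1),
     hence at most 2^-N. *)
  have Nn : (N <= n)%N.
    by rewrite leqNgt; apply/negP => /lN; rewrite ln.
  rewrite (Glead n)// -lee_fin.
  apply: le_trans (ler_norm_diam (F0 n) (hF _ _)) _.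
  apply: le_trans (diamF n.+1 isT) _.
  rewrite lee_fin div1r -exprVn.
  by apply: ler_wiXn2l; [lra|lra|exact: leqW].
- move=> [k t]; have [->|[n [kn0 kn]]] := cantor_space_lead k.
    by rewrite G0; exists 1%N => //; exact: F0.
  by rewrite (Glead n)//; exists n.+1 => //; exact: hF.
- move=> y [[//|n] _ Fy]; have [x xy] := hsurj n (SigSub (mem_set Fy)).
  have [k [t [t01 kt]]] := sp x.
  (* The sequence 0^n 1 followed by [k]. *)
  exists (fun i => if (i < n)%N then false else if i == n then true
                   else k (i - n.+1)%N), t; split=> //.
  rewrite (Glead n); last 2 first.
  + by move=> i ->.
  + by rewrite ltnn eqxx.
  rewrite /leaf /tail /= (_ : _ \o _ = k) ?kt ?xy//.
  apply/funext => i /=; rewrite ifF; last by lia.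
  by rewrite ifF; [congr k; lia|lia].
- move=> k l t u t01 u01; split=> [|[[-> ->]//|[kt lu]]]; last by rewrite !GZ.
  have [k0|[n [kn0 kn]]] := cantor_space_lead k.
    rewrite {1}k0 G0 => /esym/(G_eq0 _ _ u01) lu; right; split=> //.
    by left.
  have [l0|[m [lm0 lm]]] := cantor_space_lead l.
    rewrite {1}l0 G0 => /(G_eq0 _ _ t01) kt; right; split=> //.
    by left.
  rewrite (Glead n)// (Glead m)//; have [nm|/eqP nm] := eqVneq n m.
    subst m; move=> /set_val_inj/hinj/injp[]//.
      move=> [kl ->]; left; congr (_, _); apply/funext => i.
      have [iln|nli|->] := ltngtP i n; last by rewrite kn lm.
        by rewrite kn0 ?lm0.
      have := congr1 (fun z => z (i - n.+1)%N) kl.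
      by rewrite /tail /= addnC subnK.
    by move=> [t0 u0]; right; split; right.
  (* A point common to two different fans is the origin, which forces both heights to be 0. *)
  move=> nmE; have Fnm : (F n.+1 `&` F m.+1) (leaf n (k, t)).
    by split; [exact: hF|rewrite nmE; exact: hF].
  have := Fnm; rewrite disjF//; last by move=> -[].
  move=> n0; right; split; right; first exact: leaf_eq0 n0.
  by apply: (leaf_eq0 m l) => //; rewrite -nmE.
Qed.

Theorem theorem3p14 (R : realType) (X : topologicalType)
    (starX : star_of_cantor_fans R X) :
  exists f : X -> X, homeomorphism f /\ topologically_transitive f.
Proof.
have [F /star_parametrization[G [cG FG Gsurj GP]] [h [ch [g [hK gK cg]]]]] := starX.
set U := \bigcup_(n in _) F n in h g ch hK gK cg *.
pose GU a : U := SigSub (mem_set (FG a)).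
have cGU : continuous GU.
  have cvG : continuous (set_val \o GU) by exact: cG.
  exact: continuous_comp_initial cvG.
apply: (@transitive_homeomorphism_of_quotient R X (h \o GU)).
(* [X] inherits the Hausdorff property from the plane through the inverse homeomorphism [g] and the
   inclusion of the star. *)
- apply: (@hausdorff_injective _ _ (set_val \o g)).
  + exact: plane_hausdorff.
  + by move=> x; apply: continuous_comp; [exact: cg|exact: set_val_continuous].
  + by apply: inj_comp; [exact: set_val_inj|exact: can_inj gK].
- by move=> a; apply: continuous_comp; [exact: cGU|exact: ch].
- move=> x; have [k [t [t01 Gkt]]] := Gsurj _ (set_valP (g x)).
  exists k, t; split=> //=.
  by rewrite -[RHS]gK; congr h; exact: val_inj.
- move=> k l t u t01 u01; rewrite -(GP _ _ _ _ t01 u01) /=.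
  split=> [/(can_inj hK)/(congr1 val)//|Gkl].
  by congr h; exact: val_inj.
Qed.
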